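(* Let $K\in\mathbb{R}^{N\times N}$ be a kernel matrix and $\tilde K\in\mathbb{R}^{N\times N}$ a rank-$r$ partial Cholesky approximation of $K$ (as specified in the context), so that in particular $K\geq\tilde K\geq 0$ in the positive semidefinite order. Assume that $r$ is large enough such that $\tilde d_i=(\tilde K1_N)_i>0$ for all $i\in\{0,\ldots,N-1\}$. Then the normalized matrices $L=D^{-1/2}KD^{-1/2}$ and $\tilde L=\tilde D^{-1/2}\tilde K\tilde D^{-1/2}$ satisfy $$\lVert L-\tilde L\rVert_*\leq\Bigl[\frac{1}{d_{\min}}+\frac{\sqrt{N}}{\delta^2}\operatorname{tr}(K)+\frac{N}{4\delta^3}\operatorname{tr}(K)\operatorname{tr}(K-\tilde K)\Bigr]\operatorname{tr}(K-\tilde K).$$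
   Context: Setting. Let $k\colon\mathbb{R}^d\times\mathbb{R}^d\to\mathbb{R}$ be a kernel function that is continuous, bounded and positive semidefinite (symmetric, with positive semidefinite kernel matrices), with $k(u,v)>0$ for all $u,v\in\mathbb{R}^d$. Given samples $u_0,\ldots,u_{N-1}\in\mathbb{R}^d$, $N\in\mathbb{N}$, the kernel matrix is $K\in\mathbb{R}^{N\times N}$ with entries $K_{ij}=k(u_i,u_j)$; it is symmetric positive semidefinite with positive entries. A rank-$r$ partial Cholesky approximation ($r<N$) is a matrix $\tilde K=FF^\top$ with $F\in\mathbb{R}^{N\times r}$; it is a standing assumption that $K\geq\tilde K\geq 0$ in the positive semidefinite (Loewner) order, i.e. $\tilde K$ and $K-\tilde K$ are positive semidefinite. Notation. $1_N\in\mathbb{R}^N$ is the vector of ones. $D=\operatorname{diag}(K1_N)$ and $\tilde D=\operatorname{diag}(\tilde K1_N)$ are the diagonal matrices of row sums, with diagonal entries $d_i=(K1_N)_i>0$ and $\tilde d_i=(\tilde K1_N)_i$. Set $d_{\min}=\min_{0\leq i<N}d_i$, $\tilde d_{\min}=\min_{0\leq i<N}\tilde d_i$, $\delta=\min(d_{\min},\tilde d_{\min})$. $\lVert\cdot\rVert_*$ denotes the trace (nuclear) norm. *)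

(* Defs.v *)
From mathcomp Require Import all_boot all_order all_algebra.
From mathcomp Require Import complex.
From mathcomp Require Import all_classical all_reals all_analysis.

Set Implicit Arguments.
Unset Strict Implicit.
Unset Printing Implicit Defensive.

Import Order.TTheory GRing.Theory Num.Theory.
Import numFieldNormedType.Exports.

Local Open Scope ring_scope.
Local Open Scope complex_scope.

Section Defs.
Context {R : realType}.

Definition psdmx n (A : 'M[R]_n) : Prop :=
  A^T = A /\ forall x : 'cV[R]_n, 0 <= (x^T *m A *m x) 0 0.

Definition loewner_le n (A B : 'M[R]_n) : Prop := psdmx (B - A).

Definition kernel_matrix d n (k : 'rV[R]_d -> 'rV[R]_d -> R)
  (u : 'I_n -> 'rV[R]_d) : 'M[R]_n := \matrix_(i, j) k (u i) (u j).

(* Continuity is joint continuity, for the product topology. *)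
Definition positive_kernel d (k : 'rV[R]_d -> 'rV[R]_d -> R) : Prop :=
  [/\ continuous (fun p : 'rV[R]_d * 'rV[R]_d => k p.1 p.2),
      exists M : R, forall u v, `|k u v| <= M,
      forall u v, k u v = k v u,
      forall n (u : 'I_n -> 'rV[R]_d), psdmx (kernel_matrix k u)
    & forall u v, 0 < k u v].

(* The factor [F] need not have full column rank. *)
Definition partial_cholesky n r (K : 'M[R]_n) (F : 'M[R]_(n, r)) : Prop :=
  [/\ (r < n)%N, loewner_le 0 (F *m F^T) & loewner_le (F *m F^T) K].

(* [A *m 1], laid out as a row so that it can be passed to [diag_mx]. *)
Definition row_sums n (A : 'M[R]_n) : 'rV[R]_n := (A *m const_mx 1 : 'cV_n)^T.

(* D^(-1/2) for D = diag_mx v; used only when all entries of v are positive. *)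
Definition diag_invsqrt n (v : 'rV[R]_n) : 'M[R]_n :=
  diag_mx (map_mx (fun x => (Num.sqrt x)^-1) v).

Definition normalized_mx n (A : 'M[R]_n) : 'M[R]_n :=
  diag_invsqrt (row_sums A) *m A *m diag_invsqrt (row_sums A).

Definition min_entry n (v : 'rV[R]_n.+1) : R :=
  \big[Num.min/v 0 ord0]_(i < n.+1) v 0 i.

(* Complex eigenvalues, repeated according to algebraic multiplicity. *)
Definition eigenvalues n (A : 'M[R]_n) : seq R[i] :=
  sval (closed_field_poly_normal (char_poly (map_mx (real_complex R) A))).

(* The singular values of [A] are the square roots of the eigenvalues of
   [A^T *m A], which are real and nonnegative, so [Re] loses nothing. *)
Definition trace_norm m n (A : 'M[R]_(m, n)) : R :=
  \sum_(z <- eigenvalues (A^T *m A)) Num.sqrt (complex.Re z).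

End Defs.

(* Main.v *)
(* With S = D^(-1/2), T = Dt^(-1/2), E = S - T one has
     S K S - T Kt T = S (K - Kt) S + (T Kt E + E Kt T) + E Kt E,
   and weighted AM-GM bounds the cross terms by c T Kt T + c^-1 E Kt E in the
   Loewner order.  A symmetric M with - B <= M <= B has trace norm at most tr B
   (compare diagonal entries in an eigenbasis of M), so only traces of
   diagonal congruences remain; E is controlled by the row sums of K - Kt,
   which are at most sqrt N tr(K - Kt) by positivity. *)

Require Import Defs.
From mathcomp Require Import all_boot all_order all_algebra.
From mathcomp Require Import all_classical all_reals all_analysis.
From mathcomp Require Import complex ring lra.

Set Implicit Arguments.
Unset Strict Implicit.

Import Order.TTheory GRing.Theory Num.Theory.
Local Open Scope ring_scope.
Local Open Scope sesquilinear_scope.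
Local Notation toC R := (real_complex R).

(** * Trace norm of symmetric real matrices, through complex diagonalization *)

Lemma char_poly_conj (C : fieldType) (n : nat) (P A : 'M[C]_n) :
  P \in unitmx -> char_poly (invmx P *m A *m P) = char_poly A.
Proof.
move=> Pu; rewrite /char_poly /char_poly_mx.
have PK : map_mx polyC (invmx P) *m map_mx polyC P = 1%:M.
  by rewrite -map_mxM mulVmx // map_mx1.
have -> : 'X%:M - map_mx polyC (invmx P *m A *m P) =
  map_mx polyC (invmx P) *m ('X%:M - map_mx polyC A) *m map_mx polyC P.
  rewrite mulmxBr mulmxBl !map_mxM /=; congr (_ - _).
  by rewrite mul_mx_scalar -scalemxAl PK scalemx1.
by rewrite !det_mulmx mulrAC -det_mulmx PK det1 mul1r.
Qed.

Lemma symmx_complex_hermsym (R : rcfType) n (M : 'M[R]_n) :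
  M^T = M -> map_mx (toC R) M \is hermsymmx.
Proof.
move=> Msym; apply: realsym_hermsym.
  apply/is_hermitianmxP; rewrite expr0 scale1r map_mx_id //.
  by rewrite -[in LHS]Msym map_trmx.
by apply/mxOverP => i j; rewrite mxE complex_real.
Qed.

(** Eigenvectors come out complex, so positivity of a real form is needed on complex vectors. For v
    = a + i b, symmetry of [B] cancels the two cross terms and leaves the forms at a and b. *)
Lemma psdmx_complex (R : realType) n (B : 'M[R]_n) (v : 'rV[R[i]]_n) :
  psdmx B -> 0 <= complex.Re ((v *m map_mx (toC R) B *m v ^t*) 0 0).
Proof.
move=> [Bsym Bpos].
pose a := map_mx (@complex.Re R) v; pose b := map_mx (@complex.Im R) v.
have vE : v = map_mx (toC R) a + 'i%C *: map_mx (toC R) b.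
  by apply/rowP => j; rewrite !mxE -complexE.
have vcE : v ^t* = map_mx (toC R) a^T - 'i%C *: map_mx (toC R) b^T.
  apply/colP => j; rewrite !mxE; case: (v 0 j) => x y /=.
  by congr Complex; ring.
have cross : a *m B *m b^T = b *m B *m a^T.
  apply/matrixP => i j; rewrite !ord1.
  have -> : b *m B *m a^T = (a *m B *m b^T)^T.
    by rewrite !trmx_mul trmxK Bsym mulmxA.
  by rewrite [RHS]mxE.
have -> : v *m map_mx (toC R) B *m v ^t* =
  map_mx (toC R) (a *m B *m a^T + b *m B *m b^T).
  rewrite vcE vE !(mulmxDl, mulmxBr, mulmxDr, mulmxN, mulNmx).
  rewrite -!scalemxAr -!scalemxAl -!map_mxM cross !scalerA.
  by rewrite -expr2 sqr_i scaleN1r opprD opprK addrA addrK map_mxD.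
rewrite mxE /= mxE addr_ge0 //.
- by have := Bpos a^T; rewrite trmxK.
- by have := Bpos b^T; rewrite trmxK.
Qed.

(** By symmetry M^T M = M^2, which the unitary eigenbasis of [M] diagonalizes with the squared
    eigenvalues. These eigenvalues are real, so the square roots give their absolute values. *)
Lemma trace_norm_symm (R : realType) n (M : 'M[R]_n) (A := map_mx (toC R) M) :
  M^T = M -> trace_norm M = \sum_i `|complex.Re (spectral_diag A 0 i)|.
Proof.
move=> Msym.
have Aherm : A \is hermsymmx := symmx_complex_hermsym Msym.
have /orthomx_spectralP AE := hermitian_normalmx Aherm.
have /mxOverP spr := hermitian_spectral_diag_real Aherm.
set P := spectralmx A in AE; set sp := spectral_diag A in AE spr *.
have Pu : P \in unitmx := spectral_unit A.
have AAE : map_mx (toC R) (M^T *m M) =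
  invmx P *m diag_mx (\row_i (sp 0 i ^+ 2)) *m P.
  rewrite Msym map_mxM -/A [in LHS]AE.
  rewrite !mulmxA mulmxK // -[_ *m _ *m diag_mx sp]mulmxA mulmx_diag.
  by congr (_ *m diag_mx _ *m _); apply/rowP => i; rewrite !mxE.
rewrite /trace_norm /eigenvalues; case: closed_field_poly_normal => rs /=.
rewrite (monicP (char_poly_monic _)) scale1r AAE char_poly_conj //.
rewrite char_poly_trig ?diag_mx_is_trig //.
have -> : \prod_(i < n) ('X - (diag_mx (\row_i (sp 0 i ^+ 2)) i i)%:P) =
  \prod_(x <- [seq sp 0 i ^+ 2 | i <- index_enum 'I_n]) ('X - x%:P).
  by rewrite big_map; apply: eq_bigr => i _; rewrite !mxE eqxx.
(* The root list [rs] is an arbitrary choice, but a split monic polynomial determines its roots up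
   to order, and the sum ignores order. *)
move=> /prod_XsubC_eq rsE; rewrite -(perm_big _ rsE).
rewrite big_map; apply: eq_bigr => i _.
have /complex_realP[x ->] := spr 0 i.
by rewrite -rmorphXn /= sqrtr_sqr.
Qed.

(** Each eigenvalue of [M] is its form at a row of the unitary [P], hence is bounded in absolute
    value by the form of [B] there. These forms of [B] add up to its trace by unitary invariance. *)
Lemma trace_norm_le_tr (R : realType) n (M B : 'M[R]_n) :
  M^T = M -> loewner_le M B -> loewner_le (- M) B -> trace_norm M <= \tr B.
Proof.
move=> Msym MB NMB; rewrite trace_norm_symm //.
set A := map_mx _ M.
have Aherm : A \is hermsymmx := symmx_complex_hermsym Msym.
have /orthomx_spectralP AE := hermitian_normalmx Aherm.
have Pun := spectral_unitarymx A.
set P := spectralmx A in AE Pun; set sp := spectral_diag A in AE *.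
have spE : diag_mx sp = P *m A *m P ^t*.
  rewrite AE invmx_unitary // !mulmxA (unitarymxP _) // mul1mx.
  by rewrite -mulmxA (unitarymxP _) // mulmx1.
have formE (X : 'M[R[i]]_n) i :
  (row i P *m X *m (row i P) ^t*) 0 0 = (P *m X *m P ^t*) i i.
  by rewrite -row_mul [LHS]mxE [RHS]mxE; apply: eq_bigr => j _; rewrite !mxE.
have -> : \tr B = \sum_i complex.Re ((P *m map_mx (toC R) B *m P ^t*) i i).
  have trE : \tr (map_mx (toC R) B) = toC R (\tr B).
    by rewrite /mxtrace rmorph_sum; apply: eq_bigr => i _; rewrite mxE.
  have : \tr (P *m map_mx (toC R) B *m P ^t*) = toC R (\tr B).
    rewrite mxtrace_mulC mulmxA -invmx_unitary // mulVmx ?mul1mx //.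
    exact: unitarymx_unit.
  move/(congr1 (@complex.Re R)) => /= <-.
  by rewrite /mxtrace (raddf_sum (@complex.Re R : Rcomplex R -> R)).
apply: ler_sum => i _.
have spiE : sp 0 i = (P *m A *m P ^t*) i i.
  by rewrite -spE !mxE eqxx.
rewrite spiE ler_norml.
have ReD (x y : R[i]) : complex.Re (x + y) = complex.Re x + complex.Re y.
  by case: x; case: y.
have ReN (x : R[i]) : complex.Re (- x) = - complex.Re x by case: x.
have := psdmx_complex (row i P) MB.
have := psdmx_complex (row i P) NMB.
rewrite !map_mxB map_mxN -/A opprK !mulmxDr !mulmxDl mulmxN mulNmx.
have addE (X Y : 'M[R[i]]_1) : (X + Y) 0 0 = X 0 0 + Y 0 0 by rewrite mxE.
have oppE (X : 'M[R[i]]_1) : (- X) 0 0 = - X 0 0 by rewrite mxE.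
by rewrite !addE oppE !formE !ReD ReN => *; apply/andP; split; lra.
Qed.

(** * Entries, row sums and traces of positive semidefinite matrices *)

Section Psd.
Context {R : realType}.

Lemma psdmx_sym_form n (A : 'M[R]_n) (x y : 'cV[R]_n) :
  psdmx A -> (y^T *m A *m x) 0 0 = (x^T *m A *m y) 0 0.
Proof.
move=> [Asym _]; have -> : y^T *m A *m x = (x^T *m A *m y)^T.
  by rewrite !trmx_mul trmxK Asym mulmxA.
by rewrite mxE.
Qed.

(** Expand the nonnegative forms at c x + y and - c x + y, then divide by [c]; the sign of the cross
    term decides which of the two is used. *)
Lemma psdmx_cauchy n (A : 'M[R]_n) (x y : 'cV[R]_n) (c : R) :
  psdmx A -> 0 < c ->
  `|(x^T *m A *m y) 0 0| *+ 2
    <= c * (x^T *m A *m x) 0 0 + c^-1 * (y^T *m A *m y) 0 0.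
Proof.
move=> Apsd c0.
have expand (t : R) : ((t *: x + y)^T *m A *m (t *: x + y)) 0 0 =
    t ^+ 2 * (x^T *m A *m x) 0 0 + t * (x^T *m A *m y) 0 0 *+ 2
    + (y^T *m A *m y) 0 0.
  have -> : (t *: x + y)^T = t *: x^T + y^T by rewrite linearD linearZ.
  rewrite !mulmxDl !mulmxDr -!scalemxAr -!scalemxAl.
  have addE (X Y : 'M[R]_1) : (X + Y) 0 0 = X 0 0 + Y 0 0 by rewrite mxE.
  have scaleE a (X : 'M[R]_1) : (a *: X) 0 0 = a * X 0 0 by rewrite mxE.
  by rewrite !addE !scaleE (psdmx_sym_form x y Apsd); ring.
have pos := Apsd.2 (c *: x + y); have neg := Apsd.2 (- c *: x + y).
move: pos neg; rewrite !expand.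
set a := (x^T *m _ *m x) 0 0; set b := (x^T *m _ *m y) 0 0.
set d := (y^T *m _ *m y) 0 0 => pos neg.
have cbE : c * `|b| = `|c * b| by rewrite normrM gtr0_norm.
rewrite -(ler_pM2l c0) mulrnAr cbE mulrDr mulVKf ?gt_eqF //.
by case: (ger0P (c * b)) => _; nra.
Qed.

Lemma psdmx_delta_form n (A : 'M[R]_n) i (y : 'cV[R]_n) :
  ((delta_mx i 0 : 'cV[R]_n)^T *m A *m y) 0 0 = (A *m y) i 0.
Proof. by rewrite trmx_delta -rowE -row_mul mxE. Qed.

Lemma psdmx_diag_ge0 n (A : 'M[R]_n) i : psdmx A -> 0 <= A i i.
Proof.
by case=> _ /(_ (delta_mx i 0)); rewrite psdmx_delta_form -colE mxE.
Qed.

Lemma psdmx_tr_ge0 n (A : 'M[R]_n) : psdmx A -> 0 <= \tr A.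
Proof. by move=> Apsd; apply: sumr_ge0 => i _; exact: psdmx_diag_ge0. Qed.

Lemma psdmx_diag_le_tr n (A : 'M[R]_n) i : psdmx A -> A i i <= \tr A.
Proof.
move=> Apsd; rewrite /mxtrace (bigD1 i) //= lerDl.
by apply: sumr_ge0 => j _; exact: psdmx_diag_ge0.
Qed.

Lemma psdmx_entry_le n (A : 'M[R]_n) i j :
  psdmx A -> `|A i j| *+ 2 <= A i i + A j j.
Proof.
move=> Apsd; have := psdmx_cauchy (delta_mx i 0) (delta_mx j 0) Apsd ltr01.
by rewrite !psdmx_delta_form -!colE !mxE invr1 !mul1r.
Qed.

(** Zero trace kills the nonnegative diagonal, and the diagonal controls every other entry. *)
Lemma psdmx_tr0 n (A : 'M[R]_n) : psdmx A -> \tr A = 0 -> A = 0.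
Proof.
move=> Apsd tr0; apply/matrixP => i j; rewrite mxE.
have := psdmx_entry_le i j Apsd.
have := psdmx_diag_le_tr i Apsd; have := psdmx_diag_le_tr j Apsd.
rewrite tr0 => Aj Ai Aij; apply/eqP; rewrite -normr_le0; lra.
Qed.

Lemma psdmx_sum_le n (A : 'M[R]_n) :
  psdmx A -> \sum_i \sum_j A i j <= n%:R * \tr A.
Proof.
move=> Apsd.
have le_ij i j : A i j <= (A i i + A j j) / 2.
  have := psdmx_entry_le i j Apsd; have := ler_norm (A i j); lra.
apply: (@le_trans _ _ (\sum_i \sum_j (A i i + A j j) / 2)).
  by apply: ler_sum => i _; apply: ler_sum => j _.
under eq_bigr => i _.
  rewrite -mulr_suml big_split /= sumr_const card_ord -/(\tr A).
  over.
rewrite -mulr_suml big_split /= sumr_const card_ord sumrMnl -/(\tr A).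
by rewrite -mulr_natl; lra.
Qed.

(** The row sum is the bilinear form of [A] at e_i and the vector of ones. The weight sqrt n
    balances the estimates A_ii <= tr A and 1^T A 1 <= n tr A: both weighted terms are then at most
    sqrt n tr A. *)
Lemma psdmx_row_sums_le n (A : 'M[R]_n) i :
  psdmx A -> `|row_sums A 0 i| <= Num.sqrt n%:R * \tr A.
Proof.
move=> Apsd; case: n A i Apsd => [A []//|n] A i Apsd.
pose one : 'cV[R]_n.+1 := const_mx 1.
have s0 : 0 < Num.sqrt n.+1%:R :> R by rewrite sqrtr_gt0 ltr0n.
have := psdmx_cauchy (delta_mx i 0) one Apsd s0.
rewrite !psdmx_delta_form -colE [col _ _ _ _]mxE.
have -> : (A *m one) i 0 = row_sums A 0 i by rewrite [RHS]mxE.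
have -> : (one^T *m A *m one) 0 0 = \sum_i \sum_j A i j.
  rewrite -mulmxA mxE; apply: eq_bigr => j _; rewrite !mxE mul1r.
  by apply: eq_bigr => k _; rewrite mxE mulr1.
have := psdmx_sum_le Apsd; have := psdmx_diag_le_tr i Apsd.
have sE : n.+1%:R = Num.sqrt n.+1%:R ^+ 2 :> R by rewrite sqr_sqrtr ?ler0n.
rewrite {1}sE; set s := Num.sqrt _ in s0 *; set S := \sum_i _ => Ai SN le2.
have : s^-1 * S <= s * \tr A.
  by rewrite ler_pdivrMl // mulrA -expr2.
have : s * A i i <= s * \tr A by rewrite ler_pM2l.
by lra.
Qed.

(** * Diagonal congruences and inverse square roots *)

Lemma tr_diag_congr n (v : 'rV[R]_n) (A : 'M[R]_n) :
  \tr (diag_mx v *m A *m diag_mx v) = \sum_i v 0 i ^+ 2 * A i i.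
Proof.
apply: eq_bigr => i _; rewrite mul_mx_diag mxE mul_diag_mx mxE; ring.
Qed.

Lemma tr_diag_congr_le n (v : 'rV[R]_n) (A : 'M[R]_n) m :
  psdmx A -> (forall i, v 0 i ^+ 2 <= m) ->
  \tr (diag_mx v *m A *m diag_mx v) <= m * \tr A.
Proof.
move=> Apsd vm; rewrite tr_diag_congr mulr_sumr; apply: ler_sum => i _.
by apply: ler_wpM2r; rewrite ?psdmx_diag_ge0.
Qed.

(** With p = sqrt a and q = sqrt b, the difference is (b - a) / (p q (p + q)). Both (p q)^2 >= d^2
    and (p + q)^2 >= 4 d hold, which produces the factor 4 d^3. *)
Lemma invsqrt_sub_sqr_le (a b d : R) :
  0 < d -> d <= a -> d <= b ->
  ((Num.sqrt a)^-1 - (Num.sqrt b)^-1) ^+ 2 <= (a - b) ^+ 2 / (4 * d ^+ 3).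
Proof.
move=> d0 da db.
have a0 : 0 < a by lra.
have b0 : 0 < b by lra.
set p := Num.sqrt a; set q := Num.sqrt b.
have p0 : 0 < p by rewrite sqrtr_gt0.
have q0 : 0 < q by rewrite sqrtr_gt0.
have aE : a = p ^+ 2 by rewrite sqr_sqrtr // ltW.
have bE : b = q ^+ 2 by rewrite sqr_sqrtr // ltW.
have dd : d ^+ 2 <= (p * q) ^+ 2.
  by rewrite exprMn -aE -bE expr2 ler_pM // ltW.
have dpq : d <= p * q.
  by rewrite -(@ler_pXn2r _ 2) // nnegrE ?mulr_ge0 // ltW.
have d4 : 4 * d <= (p + q) ^+ 2 by rewrite sqrrD -aE -bE; lra.
rewrite ler_pdivlMr ?mulr_gt0 ?exprn_gt0 //.
have -> : p^-1 - q^-1 = (q - p) / (p * q) by field; rewrite !gt_eqF.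
rewrite expr_div_n mulrAC ler_pdivrMr ?exprn_gt0 ?mulr_gt0 // aE bE.
have -> : (p ^+ 2 - q ^+ 2) ^+ 2 * (p * q) ^+ 2 =
  (q - p) ^+ 2 * ((p + q) ^+ 2 * (p * q) ^+ 2) by ring.
rewrite ler_wpM2l ?sqr_ge0 //.
have -> : 4 * d ^+ 3 = 4 * d * d ^+ 2 by ring.
by apply: ler_pM => //; [lra | exact: sqr_ge0].
Qed.

Lemma min_entry_le n (v : 'rV[R]_n.+1) i : min_entry v <= v 0 i.
Proof. exact: bigmin_le. Qed.

Lemma min_entry_gt0 n (v : 'rV[R]_n.+1) :
  (forall i, 0 < v 0 i) -> 0 < min_entry v.
Proof. by move=> v0; apply: lt_bigmin. Qed.

(** * Trace norm of a difference of two congruences *)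

Lemma trace_norm_congr_sub n (A B S T : 'M[R]_n) (c : R) :
  psdmx B -> loewner_le B A -> S^T = S -> T^T = T -> 0 < c ->
  trace_norm (S *m A *m S - T *m B *m T) <=
    \tr (S *m (A - B) *m S) + c * \tr (T *m B *m T)
    + (1 + c^-1) * \tr ((S - T) *m B *m (S - T)).
Proof.
move=> Bpsd BA Ssym Tsym c0.
have Bsym := Bpsd.1.
have Asym : A^T = A by rewrite -[A](subrK B) linearD /= BA.1 Bsym.
set E := S - T; have Esym : E^T = E by rewrite linearB /= Ssym Tsym.
have congr_sym (X Y : 'M[R]_n) : X^T = X -> Y^T = Y ->
    (Y *m X *m Y)^T = Y *m X *m Y.
  by move=> Xs Ys; rewrite !trmx_mul Xs Ys mulmxA.
(* In the last coefficient, 1 absorbs the term E B E of the difference itself, and c^-1 is its share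
   of the cross terms. *)
pose U := S *m (A - B) *m S + c *: (T *m B *m T) + (1 + c^-1) *: (E *m B *m E).
have -> : \tr (S *m (A - B) *m S) + c * \tr (T *m B *m T)
    + (1 + c^-1) * \tr (E *m B *m E) = \tr U.
  by rewrite !mxtraceD !mxtraceZ.
have Usym : U^T = U.
  have trD (X Y : 'M[R]_n) : (X + Y)^T = X^T + Y^T by exact: linearD.
  have trZ a (X : 'M[R]_n) : (a *: X)^T = a *: X^T by exact: linearZ.
  by rewrite !trD !trZ !congr_sym // BA.1.
have Msym : (S *m A *m S - T *m B *m T)^T = S *m A *m S - T *m B *m T.
  by rewrite linearB /= !congr_sym.
have congr_form (X Y : 'M[R]_n) (x : 'cV[R]_n) : Y^T = Y ->
    x^T *m (Y *m X *m Y) *m x = (Y *m x)^T *m X *m (Y *m x).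
  by move=> Ys; rewrite trmx_mul Ys !mulmxA.
have addE (X Y : 'M[R]_1) : (X + Y) 0 0 = X 0 0 + Y 0 0 by rewrite mxE.
have oppE (X : 'M[R]_1) : (- X) 0 0 = - X 0 0 by rewrite mxE.
have scaleE a (X : 'M[R]_1) : (a *: X) 0 0 = a * X 0 0 by rewrite mxE.
have formD (X Y : 'M[R]_n) (x : 'cV[R]_n) :
    (x^T *m (X + Y) *m x) 0 0 = (x^T *m X *m x) 0 0 + (x^T *m Y *m x) 0 0.
  by rewrite mulmxDr mulmxDl addE.
have formN (X : 'M[R]_n) (x : 'cV[R]_n) :
    (x^T *m (- X) *m x) 0 0 = - (x^T *m X *m x) 0 0.
  by rewrite mulmxN mulNmx oppE.
have formZ a (X : 'M[R]_n) (x : 'cV[R]_n) :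
    (x^T *m (a *: X) *m x) 0 0 = a * (x^T *m X *m x) 0 0.
  by rewrite -scalemxAr -scalemxAl scaleE.
have UE (x : 'cV[R]_n) : (x^T *m U *m x) 0 0 =
    ((S *m x)^T *m (A - B) *m (S *m x)) 0 0
    + c * ((T *m x)^T *m B *m (T *m x)) 0 0
    + (1 + c^-1) * ((E *m x)^T *m B *m (E *m x)) 0 0.
  by rewrite /U 2!formD !formZ !congr_form.
have ME (x : 'cV[R]_n) : (x^T *m (S *m A *m S - T *m B *m T) *m x) 0 0 =
    ((S *m x)^T *m (A - B) *m (S *m x)) 0 0
    + ((T *m x)^T *m B *m (E *m x)) 0 0 *+ 2
    + ((E *m x)^T *m B *m (E *m x)) 0 0.
  rewrite !(formD, formN) !congr_form //.
  have -> : S *m x = T *m x + E *m x by rewrite -mulmxDl /E addrC subrK.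
  have trD (X Y : 'cV[R]_n) : (X + Y)^T = X^T + Y^T by exact: linearD.
  move: (T *m x) (E *m x) => t e; rewrite !trD !mulmxDl !mulmxDr !addE.
  by rewrite (psdmx_sym_form t e Bpsd); ring.
have cauchy (x : 'cV[R]_n) := psdmx_cauchy (T *m x) (E *m x) Bpsd c0.
have nonneg (x : 'cV[R]_n) := conj (BA.2 (S *m x)) (Bpsd.2 (E *m x)).
(* In U - M the terms S (A - B) S cancel; in U + M they double and are nonnegative. The cross terms
   are absorbed by [cauchy] in both. *)
apply: trace_norm_le_tr => //; split.
- by rewrite linearB /= Usym Msym.
- move=> x; rewrite formD formN UE ME.
  have [] := nonneg x; have := cauchy x.
  by case: (ger0P (((T *m x)^T *m B *m (E *m x)) 0 0)) => ?; lra.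
- by rewrite opprK linearD /= Usym Msym.
- move=> x; rewrite opprK formD UE ME.
  have [] := nonneg x; have := cauchy x.
  by case: (ger0P (((T *m x)^T *m B *m (E *m x)) 0 0)) => ?; lra.
Qed.

End Psd.

(* The bound for normalized kernel matrices *)
Local Close Scope sesquilinear_scope.

Theorem theorem3 (R : realType) (d n r : nat)
    (k : 'rV[R]_d -> 'rV[R]_d -> R) (u : 'I_n.+1 -> 'rV[R]_d)
    (F : 'M[R]_(n.+1, r)) :
  let N := n.+1 in
  let K := kernel_matrix k u in
  let Kt := F *m F^T in
  let dmin := min_entry (row_sums K) in
  let dtmin := min_entry (row_sums Kt) in
  let delta := Num.min dmin dtmin in
  let L := normalized_mx K in
  let Lt := normalized_mx Kt in
  positive_kernel k ->
  partial_cholesky K F ->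
  (forall i, 0 < row_sums Kt 0 i) ->
  trace_norm (L - Lt) <=
    (1 / dmin + Num.sqrt N%:R / delta ^+ 2 * \tr K
     + N%:R / (4 * delta ^+ 3) * \tr K * \tr (K - Kt)) * \tr (K - Kt).
Proof.
move=> N K Kt dmin dtmin delta L Lt [_ _ _ _ kpos] [_ Ktpsd KtK] dt0.
move: Ktpsd; rewrite /loewner_le subr0 -/Kt => Ktpsd.
(* Strict positivity of the kernel makes the row sums of [K] positive. *)
have d0 i : 0 < row_sums K 0 i.
  rewrite !mxE (bigD1 ord0) //= !mxE mulr1 ltr_pwDl ?kpos //.
  by apply: sumr_ge0 => j _; rewrite !mxE mulr1 ltW.
have dmin0 : 0 < dmin by exact: min_entry_gt0.
have delta0 : 0 < delta by rewrite lt_min dmin0 min_entry_gt0.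
have delta_d i : delta <= row_sums K 0 i.
  by rewrite ge_min min_entry_le.
have delta_dt i : delta <= row_sums Kt 0 i.
  by rewrite ge_min [X in _ || X]min_entry_le orbT.
set tau := \tr (K - Kt).
have tau_ge0 : 0 <= tau := psdmx_tr_ge0 KtK.
(* The weight [c] chosen below is proportional to [tau] and must be positive, so the case K = Kt is
   settled first. *)
have [tau0|tau_neq0] := eqVneq tau 0.
  have KKt : K = Kt by apply/eqP; rewrite -subr_eq0 (psdmx_tr0 KtK tau0).
  rewrite tau0 mulr0 /L /Lt KKt subrr.
  have psd0 : psdmx (0 : 'M[R]_n.+1).
    by split=> [|x]; rewrite ?trmx0 // mulmx0 mul0mx mxE.
  rewrite -(mxtrace0 R n.+1); apply: trace_norm_le_tr; first exact: trmx0.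
    by rewrite /loewner_le subr0.
  by rewrite /loewner_le oppr0 subr0.
have tau_gt0 : 0 < tau by rewrite lt_neqAle eq_sym tau_neq0.
have s0 : 0 < Num.sqrt N%:R :> R by rewrite sqrtr_gt0 ltr0n.
have sE : N%:R = Num.sqrt N%:R ^+ 2 :> R by rewrite sqr_sqrtr ?ler0n.
set s := Num.sqrt N%:R in s0 sE *.
(* This [c] balances the bounds on the two terms of the weighted AM-GM. *)
pose c := s * tau / (2 * delta).
have c0 : 0 < c by rewrite divr_gt0 ?mulr_gt0.
have trKt : \tr Kt <= \tr K by rewrite -subr_ge0 -linearB.
have trKt0 : 0 <= \tr Kt := psdmx_tr_ge0 Ktpsd.
have invsqrt_sq (a b : R) : 0 < a -> a <= b -> (Num.sqrt b)^-1 ^+ 2 <= a^-1.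
  move=> a0 ab; have b0 := lt_le_trans a0 ab.
  by rewrite exprVn (sqr_sqrtr (ltW b0)) lef_pV2 ?posrE.
(* Only D^(-1/2) acts on K - Kt, so this term keeps [dmin] instead of the smaller [delta]. *)
have trS : \tr (diag_invsqrt (row_sums K) *m (K - Kt)
    *m diag_invsqrt (row_sums K)) <= dmin^-1 * tau.
  by apply: tr_diag_congr_le => // i; rewrite mxE invsqrt_sq // min_entry_le.
have trT : \tr (diag_invsqrt (row_sums Kt) *m Kt
    *m diag_invsqrt (row_sums Kt)) <= delta^-1 * \tr Kt.
  by apply: tr_diag_congr_le => // i; rewrite mxE invsqrt_sq.
pose E := diag_invsqrt (row_sums K) - diag_invsqrt (row_sums Kt).
have trE : \tr (E *m Kt *m E) <= (s * tau) ^+ 2 / (4 * delta ^+ 3) * \tr Kt.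
  rewrite /E /diag_invsqrt -linearB /=; apply: tr_diag_congr_le => // i.
  set e := (X in X ^+ 2); have -> : e =
      (Num.sqrt (row_sums K 0 i))^-1 - (Num.sqrt (row_sums Kt 0 i))^-1.
    by rewrite /e !mxE.
  apply: le_trans (invsqrt_sub_sqr_le delta0 (delta_d i) (delta_dt i)) _.
  rewrite ler_pM2r ?invr_gt0 ?mulr_gt0 ?exprn_gt0 //.
  (* Since K - Kt is itself positive semidefinite, its row sums are at most [s * tau] in absolute
     value. *)
  have -> : row_sums K 0 i - row_sums Kt 0 i = row_sums (K - Kt) 0 i.
    by rewrite /row_sums mulmxBl linearB /= [RHS]mxE [X in _ = _ + X]mxE.
  rewrite -[X in X <= _]real_normK ?num_real // ler_pXn2r ?nnegrE //.
    exact: psdmx_row_sums_le.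
  by rewrite mulr_ge0 // ltW.
have diagT (v : 'rV[R]_n.+1) : (diag_invsqrt v)^T = diag_invsqrt v.
  exact: tr_diag_mx.
have := trace_norm_congr_sub Ktpsd KtK (diagT (row_sums K))
  (diagT (row_sums Kt)) c0.
rewrite -/E => /le_trans; apply; clearbody tau.
apply: (@le_trans _ _ (dmin^-1 * tau + c * (delta^-1 * \tr Kt)
  + (1 + c^-1) * ((s * tau) ^+ 2 / (4 * delta ^+ 3) * \tr Kt))).
  rewrite !lerD ?ler_pM2l //.
  by rewrite addr_gt0 ?invr_gt0.
(* For this [c], the terms in c and c^-1 both equal s tau tr(Kt) / (2 delta^2), and together they
   form the middle summand. The remaining coefficient 1 gives the summand in N / (4 delta^3). *)
have -> : dmin^-1 * tau + c * (delta^-1 * \tr Kt)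
    + (1 + c^-1) * ((s * tau) ^+ 2 / (4 * delta ^+ 3) * \tr Kt) =
  (1 / dmin + s / delta ^+ 2 * \tr Kt
   + N%:R / (4 * delta ^+ 3) * \tr Kt * tau) * tau.
  rewrite sE /c; field.
  by rewrite !gt_eqF.
(* It remains to pass from tr Kt to the larger tr K in the last two summands. *)
rewrite ler_pM2r // lerD // ?lerD //.
  by rewrite ler_pM2l // divr_gt0 ?exprn_gt0.
by rewrite ler_pM2r // ler_pM2l // divr_gt0 ?mulr_gt0 ?exprn_gt0 // ltr0n.
Qed.
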